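(* For any uncountable cardinals $\kappa\le\lambda\le\mathfrak c$, if the cofinality of $\lambda$ is uncountable, then the following are equivalent: (1) $C_8(\lambda,\kappa)$; (2) there exist a set $E\subseteq\mathbb R$ of cardinality $\lambda$, a compact metric space $Y$ and a continuous function $f:E\to Y$ which is not uniformly continuous on any subset of $E$ of cardinality $\kappa$. Moreover, any set $E\subseteq I$ that witnesses $C_8(\lambda,\kappa)$ for some continuous function from $E$ to $I$ (i.e. $|E|=\lambda$ and there is a continuous function $E\to I$ not uniformly continuous on any subset of $E$ of cardinality $\kappa$) has the property expressed in (2) with respect to any uncountable compact metric space $Y$; that is, for every uncountable compact metric space $Y$ there is a continuous function $f:E\to Y$ which is not uniformly continuous on any subset of $E$ of cardinality $\kappa$.
   Context: $\mathfrak c=2^{\aleph_0}$ and $I=[0,1]$. Subsets of $\mathbb R$ carry the Euclidean metric; a function is (not) uniformly continuous on a set $A$ if its restriction to $A$ is (not) uniformly continuous. $C_8(\lambda,\kappa)$ is the statement: there exist a set $E\subseteq\mathbb R$ of cardinality $\lambda$ and a continuous function $f:E\to\mathbb R$ which is not uniformly continuous on any subset of $E$ of cardinality $\kappa$. *)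

(* Defs.v *)
From mathcomp Require Import all_boot all_order all_algebra.
From mathcomp Require Import all_classical all_reals all_analysis.
From mathcomp Require wochoice.
Import Order.TTheory GRing.Theory Num.Theory numFieldNormedType.Exports.

Set Implicit Arguments.
Unset Strict Implicit.
Unset Printing Implicit Defensive.

Local Open Scope classical_set_scope.
Local Open Scope card_scope.
Local Open Scope ring_scope.

(* A cardinal is represented by an arbitrary type of that cardinality; all the
   notions below depend on such a type only up to bijection. *)

Definition uncountable (T : Type) := ~ countable [set: T].

(* 2 ^ aleph_0 *)
Definition continuum : Type := nat -> bool.

(* [le] well-orders [T] in the order type of the initial ordinal of |T|:
   no proper initial segment has the cardinality of [T]. *)
Definition initial_well_order (T : Type) (le : rel T) :=
  wochoice.well_order le /\
  forall x, ~ ([set: T] #<= [set y | le y x /\ y <> x]).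

Definition cofinal (T : Type) (le : rel T) (C : set T) :=
  forall x, exists2 y, C y & le x y.

(* |M| is the least cardinality of a cofinal subset of the initial ordinal
   of |T|. *)
Definition is_cofinality (T M : Type) :=
  exists le : rel T,
    [/\ initial_well_order le,
        (exists2 C, cofinal le C & C #= [set: M]) &
        (forall C, cofinal le C -> [set: M] #<= C)].

Definition uncountable_cofinality (T : Type) :=
  exists2 M : Type, is_cofinality T M & uncountable M.

(* A function on [E] is represented by a total function on [R], whose values
   outside [E] are irrelevant. [subspace A] has the uniform structure in which
   points outside [A] are isolated, uniformly so: uniform continuity on
   [subspace A] is uniform continuity of the restriction to [A]. *)
Definition unif_continuous_on (X Y : uniformType) (A : set X) (f : X -> Y) :=
  unif_continuous (f : subspace A -> Y).

Definition continuous_nowhere_unif (X Y : uniformType) (E : set X) (K : Type)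
    (f : X -> Y) :=
  {within E, continuous f} /\
  forall A, A `<=` E -> A #= [set: K] -> ~ unif_continuous_on A f.

Definition C8 (R : realType) (L K : Type) :=
  exists E : set R, E #= [set: L] /\
    exists f : R -> R, continuous_nowhere_unif E K f.

Definition C8_compact (R : realType) (L K : Type) :=
  exists E : set R, E #= [set: L] /\
    exists Y : metricType R, compact [set: Y] /\
      exists f : R -> Y, continuous_nowhere_unif E K f.

(* The sets [E] in I = [0, 1] that witness [C8] through a map from [E] to I. *)
Definition C8_unit_interval_witness (R : realType) (L K : Type) (E : set R) :=
  [/\ E `<=` `[0, 1], E #= [set: L] &
      exists2 f : R -> R, f @` E `<=` `[0, 1] & continuous_nowhere_unif E K f].

Lemma unif_continuous_onP (R : realType) (Y : metricType R) (A : set R)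
    (f : R -> Y) :
  unif_continuous_on A f <->
  forall e, 0 < e -> exists2 d, 0 < d &
    forall x y, A x -> A y -> `|x - y| < d -> mdist (f x) (f y) < e.
Proof.
split.
- move=> fA e e0.
  have : entourage [set xy : Y * Y | ball xy.1 e xy.2].
    by rewrite -entourage_ballE; exists e.
  move=> /fA -[E]; rewrite -entourage_ballE => -[d /= d0 dE] Ef.
  exists d => // x y Ax Ay xyd.
  have /= : ball (f x) e (f y).
    by apply: (Ef (x, y)); right; split => //; split => //; exact: dE.
  by rewrite ballEmdist.
- move=> fA U; rewrite -entourage_ballE => -[e /= e0 eU].
  have [d d0 dA] := fA e e0.
  exists [set xy : R * R | ball xy.1 d xy.2].
    by rewrite -entourage_ballE; exists d.
  move=> [x y] /= [->|[Ax [Ay xy]]]; apply: eU => /=; first exact: ballxx.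
  by rewrite ballEmdist; exact: dA.
Qed.

(* Main.v *)
Require Import Defs.
From HB Require Import structures.
From mathcomp Require Import all_boot all_order all_algebra.
From mathcomp Require Import all_classical all_reals all_analysis.
From mathcomp Require Import lra.
From mathcomp Require wochoice.
Import Order.TTheory GRing.Theory Num.Theory numFieldNormedType.Exports.

(** Both parts rest on one transfer principle, [nowhere_unif_transfer]: if
    [f : E -> Y] is continuous, [Y] is compact metric and [f] is not uniformly
    continuous on any subset of [E] of cardinality [K], then every uncountable
    compact metric space [Z] is the target of such a function on the same [E].

    The set [E] contains no nondegenerate segment, since [f] would be uniformly
    continuous on it and it has a subset of cardinality [K]
    ([nowhere_unif_gap]). Hence [E] is zero-dimensional, and every open cover of
    [E] has a locally constant selector ([locally_constant_selection]). Applied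
    to the preimages of finite covers of [Y] by balls of radius [1 / (n + 1)],
    this produces a continuous map from [E] to the Cantor space through which
    [f] factors, the second factor being uniformly continuous
    ([binary_factorization]). On the other hand [Z] contains a copy of the Cantor
    space ([cantor_embedding]), by the usual tree of uncountable sets around
    condensation points. The composite [E -> Z] is uniformly continuous only on
    sets where [f] is.

    With [Z] a segment, this turns a witness with an arbitrary compact target
    into a real-valued one; with [Y] a segment, it gives the second part. The
    converse implication needs the cofinality: [E] is the union over [n] of the
    sets where [|f| <= n], so one of them has the cardinality of [E]
    ([uncountable_cofinality_cover]), and on it [f] takes values in the segment
    [[- n, n]]. *)

Set Implicit Arguments.
Unset Strict Implicit.
Unset Printing Implicit Defensive.

Local Open Scope classical_set_scope.
Local Open Scope card_scope.
Local Open Scope ring_scope.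

(** * Cardinals and well-orders *)
Lemma inj_on_card_le (T U : Type) (A : set T) (B : set U) (f : T -> U) :
  (forall x, A x -> B (f x)) -> {in A &, injective f} -> A #<= B.
Proof.
move=> fAB finj; apply: (@card_le_trans _ _ _ (f @` A)).
  by have := inj_card_eq finj; rewrite card_eqPle => -[].
by apply: subset_card_le => _ [x Ax <-]; exact: fAB.
Qed.

(** [u0] is the value taken outside [A]. *)
Lemma card_le_inj_on (T U : Type) (A : set T) (B : set U) (u0 : U) :
  A #<= B -> exists2 f : T -> U,
    (forall x, A x -> B (f x)) & {in A &, injective f}.
Proof.
move=> /card_leP[h].
exists (fun x => if pselect (A x) is left Ax
                 then set_val (h (exist _ x (mem_set Ax))) else u0).
  move=> x Ax; case: pselect => // Ax'.
  by have /set_mem := valP (h (exist _ x (mem_set Ax'))).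
move=> x y /set_mem Ax /set_mem Ay; case: pselect => // Ax'; case: pselect => // Ay'.
move=> /val_inj /inj /=.
by rewrite !in_setT => /(_ isT isT) [].
Qed.

Section well_order.
Context {T : Type} {le : rel T}.
Hypothesis woT : wochoice.well_order le.

(** The proper initial segment of the elements strictly below [x]. *)
Definition strict_segment (x : T) : set T := [set y | le y x /\ y <> x].

Lemma well_order_min (A : set T) : A !=set0 ->
  exists2 x, A x & forall y, A y -> le x y.
Proof.
move=> [a Aa].
have [|m [[Am lm] _]] := @woT [pred x | `[< A x >]].
  by exists a; apply/asboolP.
exists m; first exact/asboolP.
by move=> y Ay; apply: lm; apply/asboolP.
Qed.

Lemma well_order_refl x : le x x.
Proof. by have [|y -> h] := @well_order_min [set x]; [exists x|exact: h]. Qed.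

Lemma well_order_total x y : le x y \/ le y x.
Proof.
have [|z [->|->] h] := @well_order_min [set x; y]; first by exists x; left.
- by left; apply: h; right.
- by right; apply: h; left.
Qed.

Lemma well_order_anti x y : le x y -> le y x -> x = y.
Proof.
move=> xy yx.
have [|z [_ uz]] := @woT [pred z | `[< z = x \/ z = y >]].
  by exists x; apply/asboolP; left.
transitivity z; first apply/esym.
- apply: uz; split; first by apply/asboolP; left.
  by move=> t /asboolP[->//|->//]; exact: well_order_refl.
- apply: uz; split; first by apply/asboolP; right.
  by move=> t /asboolP[->//|->//]; exact: well_order_refl.
Qed.

Lemma well_order_trans x y z : le x y -> le y z -> le x z.
Proof.
move=> xy yz.
have [|t tA tm] := @well_order_min [set x; y; z]; first by exists x; left; left.
have : [/\ le t x, le t y & le t z].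
  by split; apply: tm; [left; left|left; right|right].
case: tA => [[->|->]|->] [// tx ty tz].
- by rewrite -(well_order_anti xy tx) in yz.
- by rewrite (well_order_anti yz ty) in xy.
Qed.

Lemma strict_segmentP x y : strict_segment x y <-> ~ le x y.
Proof.
split=> [[yx ne] xy|nxy]; first by apply: ne; exact: well_order_anti.
by have [//|yx] := well_order_total x y; split=> // E; rewrite E in nxy;
  apply: nxy; exact: well_order_refl.
Qed.

Lemma strict_segment_trans x y z :
  strict_segment z y -> strict_segment y x -> strict_segment z x.
Proof.
move=> /strict_segmentP zy [xy _]; apply/strict_segmentP => zx; apply: zy.
exact: well_order_trans zx xy.
Qed.

(** The relation is the strict order: [strict_segment x y] reads [y < x]. *)
Lemma strict_segment_wf : well_founded (fun y x => strict_segment x y).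
Proof.
move=> x; apply: contrapT => nx.
have [|m nm mmin] := @well_order_min [set x | ~ Acc (fun y x => strict_segment x y) x].
  by exists x.
apply: nm; constructor => y ym; apply: contrapT => ny.
by move/strict_segmentP : ym; apply; exact: mmin.
Qed.

(** A cardinal strictly smaller than that of [T] is at most that of a proper
    initial segment. Otherwise no map defined on a segment is onto [B], and
    choosing for each [x] a point of [B] not taken below [x] embeds [T] in
    [B]. *)
Lemma card_le_segment (U : Type) (B : set U) :
  ~ ([set: T] #<= B) -> exists x, B #<= strict_segment x.
Proof.
move=> TB; apply: contrapT => /forallNP nB; apply: TB.
have [[x0 _]|T0] := pselect ([set: T] !=set0); last first.
  by rewrite (_ : [set: T] = set0) ?card_ge0//; exact/eqP/negPn/negP/set0P.
have [[b Bb]|B0] := pselect (B !=set0); last first.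
  exfalso; apply: (nB x0).
  by rewrite (_ : B = set0) ?card_ge0//; exact/eqP/negPn/negP/set0P.
(* The default value [b] is never taken, by [eP] below. *)
pose F x (e : forall y, strict_segment x y -> U) : U :=
  if pselect (exists u, B u /\ forall y (yx : strict_segment x y), e y yx <> u)
  is left ex then projT1 (cid ex) else b.
pose e := Fix strict_segment_wf (fun _ => U) F.
have eE x : e x = F x (fun y _ => e y).
  apply: Fix_eq => z f g fg; congr F.
  apply: functional_extensionality_dep => y.
  by apply: functional_extensionality_dep => yz.
have eP x : B (e x) /\ forall y, strict_segment x y -> e y <> e x.
  rewrite eE /F; case: pselect => [ex|nu]; first exact: (projT2 (cid ex)).
  exfalso; apply: (nB x).
  apply: (@card_le_trans _ _ _ (e @` strict_segment x)); last exact: card_image_le.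
  apply: subset_card_le => u Bu; apply: contrapT => nx; apply: nu; exists u.
  by split=> // y yx E; apply: nx; exists y.
apply: (@inj_on_card_le _ _ _ _ e) => [x _|x y _ _ E]; first by have [] := eP x.
have [xy|nxy] := pselect (strict_segment y x).
  by have [_ /(_ _ xy)] := eP y.
have [yx|nyx] := pselect (strict_segment x y).
  by have [_ /(_ _ yx)] := eP x; rewrite E.
apply: well_order_anti; apply: contrapT => h.
- by apply: nyx; apply/strict_segmentP.
- by apply: nxy; apply/strict_segmentP.
Qed.

(** From here on the cofinality of the order is uncountable. *)
Hypothesis no_countable_cofinal :
  forall u : nat -> T, exists x, forall n, ~ le x (u n).

Lemma exists_successor x :
  exists y, ~ le y x /\ forall z, ~ le z x -> le y z.
Proof.
have [|y yx ymin] := @well_order_min [set y | ~ le y x]; last by exists y.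
by have [y /(_ 0%N)] := no_countable_cofinal (fun=> x); exists y.
Qed.

(** The least element strictly above [x]. *)
Definition successor x := projT1 (cid (exists_successor x)).

Lemma successor_gt x : strict_segment (successor x) x.
Proof. by apply/strict_segmentP; have [] := projT2 (cid (exists_successor x)). Qed.

Lemma successor_le x y : strict_segment y x -> le (successor x) y.
Proof. by move/strict_segmentP; have [_] := projT2 (cid (exists_successor x)); apply. Qed.

Lemma successor_inj : injective successor.
Proof.
move=> x y E; apply: well_order_anti; apply: contrapT => /strict_segmentP xy.
- have /strict_segmentP := successor_gt x; apply.
  by rewrite E; exact: successor_le.
- have /strict_segmentP := successor_gt y; apply.
  by rewrite -E; exact: successor_le.
Qed.

Lemma successor_mono x y : le x y -> le (successor x) (successor y).
Proof.
move=> xy; apply: successor_le; apply/strict_segmentP => yx.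
have /strict_segmentP := successor_gt y; apply.
exact: well_order_trans yx xy.
Qed.

(** The elements that are not successors, the least one included. *)
Definition limit_element l := forall y, successor y <> l.

(** Every ordinal is a limit plus a natural number. *)
Lemma iter_successor_limit x : exists ln : T * nat,
  limit_element ln.1 /\ x = iter ln.2 successor ln.1.
Proof.
elim/(well_founded_ind strict_segment_wf) : x => x IH.
have [lx|] := pselect (limit_element x); first by exists (x, 0%N).
move=> /existsNP[y /contrapT yx].
have [|[l n] /= [ll yE]] := IH y; first by rewrite -yx; exact: successor_gt.
by exists (l, n.+1); split=> //=; rewrite -yE.
Qed.

Lemma iter_successor_inj l l' n n' :
  limit_element l -> limit_element l' ->
  iter n successor l = iter n' successor l' -> l = l' /\ n = n'.
Proof.
move=> ll ll'; elim: n n' => [|n IH] [|n'] //=.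
- by move=> E; exfalso; exact: (ll _ (esym E)).
- by move=> E; exfalso; exact: (ll' _ E).
- by move=> /successor_inj/IH[-> ->].
Qed.

(** aleph_0 * |x| <= |x| for a limit [x]: write [y] as a limit plus [n] and send
    [(k, y)] to the same limit plus a code of [(k, n)]. *)
Lemma card_nat_mul_segment x :
  (forall y, strict_segment x y -> strict_segment x (successor y)) ->
  [set: nat] `*` strict_segment x #<= strict_segment x.
Proof.
move=> xS.
pose ln y := projT1 (cid (iter_successor_limit y)).
have lnP y : limit_element (ln y).1 /\ y = iter (ln y).2 successor (ln y).1.
  exact: (projT2 (cid (iter_successor_limit y))).
have le_iter n y : le y (iter n successor y).
  elim: n => [|n IH] /=; first exact: well_order_refl.
  by apply: well_order_trans IH _; have [] := successor_gt (iter n successor y).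
apply: (@inj_on_card_le _ _ _ _
    (fun ky => iter (pickle (ky.1, (ln ky.2).2)) successor (ln ky.2).1)).
  move=> [k y] [_ /= xy].
  elim: (pickle _) => [|n IH] /=; last exact: xS.
  have [_ yE] := lnP y; apply/strict_segmentP => xl.
  move/strict_segmentP : xy; apply; rewrite yE.
  exact: well_order_trans xl _.
move=> [k y] [k' y'] _ _ /=.
have [[ly yE] [ly' yE']] := (lnP y, lnP y').
case/(iter_successor_inj ly ly') => El /(pcan_inj pickleK)[-> En].
by rewrite yE yE' El En.
Qed.

(** A countable family of sets smaller than [T] does not cover [T]: the
    cardinals of its members are bounded by that of one segment, whose product
    with [nat] is no larger, since its end can be taken to be a limit. *)
Lemma countable_cover_card (A : nat -> set T) :
  (forall x, ~ ([set: T] #<= strict_segment x)) ->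
  (forall x, exists n, A n x) -> exists n, [set: T] #<= A n.
Proof.
move=> init Acov; apply: contrapT => /forallNP nA.
have [x_ xP] : {x_ : nat -> T & forall n, A n #<= strict_segment (x_ n)}.
  apply: (@choice _ _ (fun n x => A n #<= strict_segment x)) => n.
  exact: card_le_segment.
have [|x /= xu xmin] := @well_order_min
    [set x | forall n m, ~ le x (iter m successor (x_ n))].
  have [x xP'] := no_countable_cofinal
    (fun k => if unpickle k is Some nm then iter nm.2 successor (x_ nm.1) else x_ 0%N).
  by exists x => n m; have := xP' (pickle (n, m)); rewrite pickleK.
have xS y : strict_segment x y -> strict_segment x (successor y).
  move=> xy; have : ~ forall n m, ~ le y (iter m successor (x_ n)).
    by move=> /xmin; move/strict_segmentP : xy.
  move=> /existsNP[n /existsNP[m /contrapT yx]].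
  apply/strict_segmentP => xSy; apply: (xu n m.+1) => /=.
  exact: well_order_trans xSy (successor_mono yx).
apply: (init x); apply: card_le_trans (card_nat_mul_segment xS).
have fP n : exists f : T -> T,
    (forall t, A n t -> strict_segment x (f t)) /\ {in A n &, injective f}.
  have [|f fA finj] := @card_le_inj_on _ _ (A n) (strict_segment x) x.
    apply: card_le_trans (xP n) _; apply: subset_card_le => y.
    move=> yx; apply: strict_segment_trans _ yx.
    by apply/strict_segmentP; exact: (xu n 0%N).
  by exists f.
have [f_ f_P] := choice fP.
have [n_ n_P] := choice Acov.
apply: (@inj_on_card_le _ _ _ _ (fun t => (n_ t, f_ (n_ t) t))).
  by move=> t _; split=> //=; have [+ _] := f_P (n_ t); apply.
move=> t t' _ _ [E]; rewrite -E.
by have [_] := f_P (n_ t); apply; rewrite inE//; rewrite E.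
Qed.

End well_order.

(** A cardinal of uncountable cofinality is not a countable union of smaller
    ones. *)
Lemma uncountable_cofinality_cover (L : Type) (A : nat -> set L) :
  uncountable_cofinality L -> (forall x, exists n, A n x) ->
  exists n, A n #= [set: L].
Proof.
move=> [M [le [[wo init] _ cofM]] uM] Acov.
have nc (u : nat -> L) : exists x, forall n, ~ le x (u n).
  apply: contrapT => /forallNP h; apply: uM.
  apply: (@sub_countable _ _ _ (range u)).
    apply: cofM => x; have /existsNP[n /contrapT xu] := h x.
    by exists (u n) => //; exists n.
  exact: card_image_le.
have [n nL] := countable_cover_card wo nc init Acov.
by exists n; rewrite card_eqPle; split=> //; exact: card_leT.
Qed.

(** * Compact metric spaces *)
Lemma within_continuousP (R : realType) (Y : metricType R) (E : set R)
    (f : R -> Y) :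
  {within E, continuous f} <->
  forall x, E x -> forall e, 0 < e -> exists2 d, 0 < d &
    forall y, E y -> `|x - y| < d -> mdist (f x) (f y) < e.
Proof.
rewrite subspace_continuousP; split=> fE x Ex.
- move=> e e0; have := fE x Ex (ball (f x) e) (nbhsx_ballx _ _ e0).
  move=> [d /= d0 dE]; exists d => // y Ey xyd.
  by have := dE y xyd Ey; rewrite ballEmdist.
- move=> U /nbhs_ballP[e /= e0 eU].
  have [d d0 dE] := fE x Ex e e0.
  exists d => // y /= xyd Ey; apply: eU; rewrite ballEmdist.
  exact: dE.
Qed.

Lemma mdistRE (R : realType) (x y : R) : @mdist R R^o x y = `|x - y|.
Proof. exact: distrC. Qed.

Lemma unif_continuous_onRP (R : realType) (A : set R) (f : R -> R) :
  unif_continuous_on A f <->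
  forall e, 0 < e -> exists2 d, 0 < d &
    forall x y, A x -> A y -> `|x - y| < d -> `|f x - f y| < e.
Proof.
rewrite (@unif_continuous_onP R R^o).
by split=> fA e /fA[d d0 dA]; exists d => // x y Ax Ay xy;
  have := dA x y Ax Ay xy; rewrite mdistRE.
Qed.

Lemma within_continuousRP (R : realType) (E : set R) (f : R -> R) :
  {within E, continuous f} <->
  forall x, E x -> forall e, 0 < e -> exists2 d, 0 < d &
    forall y, E y -> `|x - y| < d -> `|f x - f y| < e.
Proof.
rewrite (@within_continuousP R R^o).
by split=> fE x Ex e /(fE x Ex)[d d0 dE]; exists d => // y Ey xy;
  have := dE y Ey xy; rewrite mdistRE.
Qed.

(** The radius of the balls may depend on their centre. *)
Lemma compact_ball_cover (R : realType) (Y : metricType R) (r : Y -> R) :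
  compact [set: Y] -> (forall y, 0 < r y) ->
  exists s : seq Y, forall y, exists2 p, p \in s & mdist p y < r p.
Proof.
move=> cY r0; have [[y0 _]|Y0] := pselect ([set: Y] !=set0); last first.
  by exists [::] => y; exfalso; apply: Y0; exists y.
pose Yp : ptopologicalType := HB.pack (Metric.sort Y) (isPointed.Build Y y0).
have : @cover_compact Yp setT by rewrite -compact_cover.
move=> /(_ Y setT (fun p => (ball p (r p))^°)) [].
- by move=> p _; exact: open_interior.
- by move=> p _; exists p => //; apply: nbhsx_ballx.
move=> D _ Dcov; exists (finmap.enum_fset D) => y.
have [//|p /= pD /interior_subset] := Dcov y.
by rewrite ballEmdist => py; exists p.
Qed.

Lemma compact_cluster_seq (R : realType) (Y : metricType R) (u : nat -> Y) :
  compact [set: Y] ->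
  exists y, forall e N, 0 < e -> exists2 n, (N <= n)%N & mdist y (u n) < e.
Proof.
move=> cY; have [|y [_ yu]] := cY (u @ \oo) _; first exact: filterT.
exists y => e N e0.
have [||z [[n Nn <-] yz]] := yu (u @` [set n | (N <= n)%N]) (ball y e).
- by exists N => // n /= Nn; exists n.
- exact: nbhsx_ballx.
by exists n => //; move: yz; rewrite ballEmdist.
Qed.

(** A subset of a metric space is a metric space. *)
Section set_type_metric.
Context {R : realType} {X : metricType R} (A : set X).

Let dist (x y : A) : R := mdist (set_val x) (set_val y).

Let dist_ge0 x y : 0 <= dist x y.
Proof. exact: mdist_ge0. Qed.

Let dist_positivity x y : dist x y = 0 -> x = y.
Proof. by move/mdist_positivity/val_inj. Qed.

Let ballEdist (x : A) d : ball x d = [set y | dist x y < d].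
Proof. by rewrite -[LHS]initial_ballE ballEmdist. Qed.

HB.instance Definition _ :=
  @PseudoMetric_isMetric.Build R A dist dist_ge0 dist_positivity ballEdist.

End set_type_metric.

Lemma compact_set_type (R : realType) (X : metricType R) (A : set X) :
  compact A -> compact [set: A].
Proof.
move=> cA F FF _.
have [|x [Ax xF]] := cA (@set_val _ A @ F) _.
  by rewrite nbhs_simpl /=; apply: filterE => a; exact: set_valP.
exists (exist _ x (mem_set Ax)); split=> // B V FB /nbhs_ballP[e /= e0 eV].
have FiB : (set_val @ F) (set_val @` B).
  by rewrite nbhs_simpl /=; apply: filterS FB => b Bb; exists b.
have [_ [[b Bb <-] xb]] := xF _ _ FiB (nbhsx_ballx x e e0).
by exists b; split=> //; exact: eV.
Qed.

Lemma compact_unif_continuous (R : realType) (Y : metricType R) (A : set R)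
    (f : R -> Y) :
  compact A -> {within A, continuous f} -> unif_continuous_on A f.
Proof.
move=> cA /within_continuousP fA; apply/unif_continuous_onP => e e0.
have fd (x : set_type A) : exists d, 0 < d /\
    forall y, A y -> `|val x - y| < d -> mdist (f (val x)) (f y) < e / 2.
  have [|d d0 dA] := fA (val x) (set_valP x) (e / 2); first exact: divr_gt0.
  by exists d.
have [d_ d_P] := choice fd.
have [s sP] := @compact_ball_cover R (A : set R^o) (fun x => d_ x / 2)
  (@compact_set_type R R^o A cA) (fun x => divr_gt0 (proj1 (d_P x)) (ltr0Sn _ _)).
have [d d0 ds] : exists2 d, 0 < d & forall x, x \in s -> d <= d_ x / 2.
  elim: (s) => [|x t [d d0 dt]]; first by exists 1.
  exists (Num.min d (d_ x / 2)).
    by rewrite lt_min d0 divr_gt0//; exact: (proj1 (d_P x)).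
  move=> y; rewrite inE => /orP[/eqP ->|/dt yt]; first by rewrite ge_min lexx orbT.
  by rewrite ge_min yt.
exists d => // x y Ax Ay xy.
have [p ps px] := sP (exist _ x (mem_set Ax)).
have {}px : `|val p - x| < d_ p / 2 by move: px; rewrite /mdist/= distrC.
have [dp0 dpP] := d_P p.
have dp := ds p ps.
rewrite (splitr e); apply: le_lt_trans (metric_triangle _ (f (val p)) _) _.
apply: ltrD.
- by rewrite metric_sym; apply: dpP => //; lra.
- apply: dpP => //; apply: le_lt_trans (ler_distD x _ _) _; lra.
Qed.

(** * Cantor sets in uncountable compact metric spaces *)

(** An uncountable set has a condensation point other than [q]: if every
    [p != q] had a ball meeting [S] in a countable set, then by compactness
    [S] would be countable outside each ball around [q]. *)
Lemma condensation_point (R : realType) (Y : metricType R) (S : set Y) (q : Y) :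
  compact [set: Y] -> ~ countable S ->
  exists2 p, p != q & forall e, 0 < e -> ~ countable (S `&` ball p e).
Proof.
move=> cY uS; apply: contrapT => nq; apply: uS.
have ex p : exists e, 0 < e /\ (p != q -> countable (S `&` ball p e)).
  have [->|pq] := eqVneq p q; first by exists 1.
  apply: contrapT => h; apply: nq; exists p => // e e0 cS.
  by apply: h; exists e.
have [e_ eP] := choice ex.
have far n : countable (S `\` ball q n.+1%:R^-1).
  have [|s sP] := compact_ball_cover
      (r := fun p => if p == q then n.+1%:R^-1 else e_ p) cY.
    by move=> y; case: ifP => _; [rewrite invr_gt0 ltr0Sn|have [] := eP y].
  apply: (@sub_countable _ _ _
     (\bigcup_(p in [set p | p \in s /\ p != q]) (S `&` ball p (e_ p)))).
    apply: subset_card_le => y [Sy nqy].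
    have [p ps] := sP y; case: eqVneq => [->|pq] py.
      by exfalso; apply: nqy; rewrite ballEmdist.
    by exists p => //; split=> //; rewrite ballEmdist.
  apply: bigcup_countable => [|p [ps pq]]; last by have [_] := eP p; apply.
  apply: (@sub_countable _ _ _ [set` s]); last exact/finite_set_countable/finite_seq.
  by apply: subset_card_le => p [].
apply: (@sub_countable _ _ _
  ([set q] `|` \bigcup_(n in [set: nat]) (S `\` ball q n.+1%:R^-1))).
  apply: subset_card_le => y Sy.
  have [->|yq] := eqVneq y q; [by left|right].
  have dq : 0 < mdist q y by rewrite mdist_gt0 eq_sym.
  exists (Num.trunc (mdist q y)^-1) => //; split=> //; rewrite ballEmdist /= => h.
  have := truncnS_gt (mdist q y)^-1; apply/negP; rewrite -leNgt ltW//.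
  by rewrite -[ltLHS]invrK ltf_pV2// posrE invr_gt0 ltr0Sn.
rewrite -bigcup2E; apply: bigcup_countable => // -[|[|n]] _ //=.
by apply: bigcup_countable => // n _; exact: far.
Qed.

(** A positive function of the first [n] bits has a positive lower bound. *)
Lemma finitely_many_prefixes (R : realType) (n : nat) (g : (nat -> bool) -> R) :
  (forall a, 0 < g a) ->
  (forall a b, (forall i, (i < n)%N -> a i = b i) -> g a = g b) ->
  exists2 d, 0 < d & forall a, d <= g a.
Proof.
elim: n g => [|n IH] g g0 gn.
  by exists (g (fun=> true)) => // a; rewrite (gn a (fun=> true)).
pose pre (b : bool) (a : nat -> bool) i := if i is j.+1 then a j else b.
have st b : exists2 d, 0 < d & forall a, d <= g (pre b a).
  apply: IH => [a|a a' aa'] //; apply: gn => -[|i] //=; exact: aa'.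
have [[d d0 dP] [d' d'0 d'P]] := (st true, st false).
exists (Num.min d d'); first by rewrite lt_min d0.
move=> a; rewrite (gn a (pre (a 0%N) (fun i => a i.+1))); last by case.
by case: (a 0%N); rewrite ge_min ?dP ?d'P ?orbT.
Qed.

Section cantor_scheme.
Context {R : realType} {Y : metricType R}.
Hypotheses (cY : compact [set: Y]) (uY : uncountable Y).

(** Every uncountable set has two distinct condensation points, indexed by
    [bool]; the value on countable sets is irrelevant. *)
Let branch_ex (S : set Y) : exists q : bool -> Y, ~ countable S ->
  q false != q true /\ forall b e, 0 < e -> ~ countable (S `&` ball (q b) e).
Proof.
have [y0 _] : exists y0 : Y, True.
  apply: contrapT => h; apply: uY.
  by rewrite (_ : [set: Y] = set0)//; apply/seteqP; split=> // y _; apply: h; exists y.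
have [cS|uS] := pselect (countable S); first by exists (fun=> y0).
have [p py pS] := condensation_point y0 cY uS.
have [p' pp' p'S] := condensation_point p cY uS.
exists (fun b => if b then p else p') => _; split=> // -[] //.
Qed.

Let q S := projT1 (cid (branch_ex S)).

(** Balls of radius [r n S] around the two condensation points of [S] are small
    and far apart. *)
Let r n S : R := Num.min n.+1%:R^-1 (mdist (q S false) (q S true) / 4).

(** The uncountable set reached after [n] steps along the branch [a]. *)
Fixpoint cell (a : nat -> bool) n : set Y :=
  if n is m.+1 then cell a m `&` ball (q (cell a m) (a m)) (r m (cell a m)) else setT.

Let cellP a n : ~ countable (cell a n) /\ 0 < r n (cell a n) .
Proof.
have rS m S : ~ countable S -> 0 < r m S.
  move=> uS; have [qS _] := projT2 (cid (branch_ex S)) uS.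
  by rewrite lt_min invr_gt0 ltr0Sn divr_gt0// mdist_gt0.
elim: n => [|n [uc r0]]; first by split; [exact: uY|exact: rS].
suff: ~ countable (cell a n.+1) by split=> //; exact: rS.
by have [_] := projT2 (cid (branch_ex _)) uc; apply.
Qed.

Let cell_eq a a' n : (forall i, (i < n)%N -> a i = a' i) -> cell a n = cell a' n.
Proof.
elim: n => [//|n IH] aa' /=.
by rewrite IH ?aa'// => i ni; apply: aa'; rewrite ltnW.
Qed.

Let cell_subset a m n : (m <= n)%N -> cell a n `<=` cell a m.
Proof.
elim: n => [|n IH]; first by rewrite leqn0 => /eqP ->.
by rewrite leq_eqVlt => /orP[/eqP -> //|/IH h] y [/h].
Qed.

(** A point in the closure of all the cells of the branch [a]. *)
Let branch_point_ex a : exists y, forall n e, 0 < e ->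
  exists2 z, cell a n z & mdist y z < e.
Proof.
have ne n : exists z, cell a n z.
  apply: contrapT => h; have [+ _] := cellP a n; apply.
  by rewrite (_ : cell a n = set0)//; apply/seteqP; split=> // y ay; apply: h; exists y.
have [u uP] := choice ne.
have [y yu] := compact_cluster_seq u cY.
exists y => n e e0; have [m nm ym] := yu e n e0.
by exists (u m) => //; exact: (cell_subset nm).
Qed.

Let psi a := projT1 (cid (branch_point_ex a)).

Let psi_near a n : mdist (psi a) (q (cell a n) (a n)) <= r n (cell a n).
Proof.
apply/ler_addgt0Pl => e e0.
have [z [_ +] pz] := projT2 (cid (branch_point_ex a)) n.+1 e e0.
rewrite ballEmdist /= metric_sym => /ltW zq.
by apply: le_trans (metric_triangle _ z _) _; apply: lerD => //; exact: ltW.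
Qed.

(** The Cantor space embeds in [Y], and the embedding and its inverse are
    uniformly continuous; the uniform structure of the Cantor space is expressed
    by agreement on the first [N] bits. *)
Lemma cantor_embedding : exists psi : (nat -> bool) -> Y,
  (forall e, 0 < e -> exists N, forall a a',
     (forall i, (i < N)%N -> a i = a' i) -> mdist (psi a) (psi a') < e) /\
  (forall N, exists2 d, 0 < d & forall a a', mdist (psi a) (psi a') < d ->
     forall i, (i < N)%N -> a i = a' i).
Proof.
exists psi; split.
- move=> e e0; pose n := Num.trunc (2 / e).
  have ne : n.+1%:R^-1 < e / 2.
    have : 2 / e < n.+1%:R by exact: truncnS_gt.
    by rewrite -[X in _ -> _ < X]invf_div ltf_pV2 // posrE ?ltr0Sn ?divr_gt0.
  exists n.+1 => a a' aa'.
  have ca : cell a n = cell a' n by apply: cell_eq => i ni; apply: aa'; exact: ltnW.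
  have h b : r n (cell b n) < e / 2 by rewrite gt_min ne.
  rewrite (splitr e); apply: le_lt_trans (metric_triangle _ (q (cell a n) (a n)) _) _.
  apply: ltrD; first exact: le_lt_trans (psi_near a n) (h _).
  rewrite metric_sym ca aa'//; exact: le_lt_trans (psi_near a' n) (h _).
- elim=> [|n [d d0 dP]]; first by exists 1.
  pose gap a := mdist (q (cell a n) false) (q (cell a n) true) / 2.
  have [|a b ab|d' d'0 d'P] := @finitely_many_prefixes R n gap.
  + move=> a; have [uc _] := cellP a n.
    have [qS _] := projT2 (cid (branch_ex _)) uc.
    by rewrite divr_gt0// mdist_gt0.
  + by rewrite /gap (cell_eq ab).
  exists (Num.min d d'); first by rewrite lt_min d0.
  move=> a a'; rewrite lt_min => /andP[/dP aa' aad'] i.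
  rewrite ltnS leq_eqVlt => /orP[/eqP ->|]; last exact: aa'.
  apply/eqP/negPn/negP => ne.
  move: aad'; apply/negP; rewrite -leNgt; apply: le_trans (d'P a) _.
  have pa := psi_near a n.
  have pa' := psi_near a' n; rewrite -(cell_eq aa') in pa'.
  have t1 := metric_triangle (q (cell a n) (a n)) (psi a) (q (cell a n) (a' n)).
  have t2 := metric_triangle (psi a) (psi a') (q (cell a n) (a' n)).
  have rq : r n (cell a n) <= mdist (q (cell a n) false) (q (cell a n) true) / 4.
    by rewrite ge_min lexx orbT.
  have E : mdist (q (cell a n) (a n)) (q (cell a n) (a' n)) =
           mdist (q (cell a n) false) (q (cell a n) true).
    by move: ne; case: (a n); case: (a' n) => //= _; rewrite metric_sym.
  rewrite metric_sym in pa.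
  rewrite /gap; lra.
Qed.

End cantor_scheme.

(** * Locally constant selections on a set of reals without interior *)
Lemma uniform_radius (R : realType) (N : nat) (P : nat -> R -> Prop) :
  (forall n d d', d' <= d -> P n d -> P n d') ->
  (forall n, exists2 d, 0 < d & P n d) ->
  exists2 d, 0 < d & forall n, (n < N)%N -> P n d.
Proof.
move=> Pmono Pex; elim: N => [|N [d d0 dP]]; first by exists 1.
have [d' d'0 d'P] := Pex N.
exists (Num.min d d'); first by rewrite lt_min d0.
move=> n; rewrite ltnS leq_eqVlt => /orP[/eqP ->|nN].
  by apply: Pmono d'P; rewrite ge_min lexx orbT.
by apply: Pmono (dP n nN); rewrite ge_min lexx.
Qed.

Lemma same_side (R : realType) (x y c : R) :
  `|x - y| < `|x - c| -> (c < y) = (c < x) /\ (y < c) = (x < c).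
Proof.
have [xc|xc|->] := ltgtP x c; last by rewrite subrr normr0 normr_lt0.
- rewrite (ltr0_norm (_ : x - c < 0)) ?subr_lt0// ltr_norml => h.
  by split; [apply/negbTE; rewrite -leNgt|]; lra.
- rewrite (gtr0_norm (_ : 0 < x - c)) ?subr_gt0// ltr_norml => h.
  by split; [|apply/negbTE; rewrite -leNgt]; lra.
Qed.

(** If the complement of [E] is dense, every open cover [U] of [E] has a locally
    constant selector [c]. The intervals with endpoints in a countable dense
    subset of the complement are clopen in [E]; those contained in a member of
    the cover are enumerated, and [c x] depends only on the first of them that
    contains [x]. *)
Lemma locally_constant_selection (R : realType) (E : set R) (T : Type) (t0 : T)
    (U : T -> set R) :
  (forall a b, a < b -> exists2 c, a < c < b & ~ E c) ->
  (forall x, E x -> exists t, exists2 d, 0 < d &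
     forall y, E y -> `|x - y| < d -> U t y) ->
  exists c : R -> T, forall x, E x -> U (c x) x /\
     exists2 d, 0 < d & forall y, E y -> `|x - y| < d -> c y = c x.
Proof.
move=> Egap EU.
have gap_ex (p : rat * rat) : exists c : R, ~ E c /\
    (p.1 < p.2 -> ratr p.1 < c < ratr p.2).
  have [p12|p21] := ltP p.1 p.2.
    by have [|c pcp nEc] := Egap (ratr p.1) (ratr p.2); [rewrite ltr_rat|exists c].
  by have [c _ nEc] := Egap 0 1 ltr01; exists c; split=> //; rewrite ltNge p21.
have [g gP] := choice gap_ex.
have gap_between a b : a < b -> exists p, a < g p < b.
  move=> ab; have [q1] := rat_in_itvoo ab; rewrite in_itv /= => /andP[aq1 q1b].
  have [q2] := rat_in_itvoo q1b; rewrite in_itv /= => /andP[q12 q2b].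
  exists (q1, q2); have [_ /=] := gP (q1, q2); rewrite -(ltr_rat R) => /(_ q12).
  by move=> /andP[h1 h2]; rewrite (lt_trans aq1 h1) (lt_trans h2 q2b).
(* [I n] is the [n]-th interval; [P x n]: it contains [x] and lies in one [U t]. *)
pose I n y := if unpickle n is Some pq then g pq.1 < y < g pq.2 else false.
pose P x n := I n x /\ exists t, forall y, E y -> I n y -> U t y.
have Pex x : E x -> exists n, P x n.
  move=> Ex; have [t [d d0 dU]] := EU x Ex.
  have [p /andP[xp px]] : exists p, x - d < g p < x by apply: gap_between; lra.
  have [q /andP[xq qx]] : exists q, x < g q < x + d by apply: gap_between; lra.
  exists (pickle (p, q)); split; first by rewrite /I pickleK px xq.
  exists t => y Ey; rewrite /I pickleK /= => /andP[py yq]; apply: dU => //.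
  by rewrite ltr_distl; apply/andP; split; lra.
have Iclopen x n : E x ->
    exists2 d, 0 < d & forall y, E y -> `|x - y| < d -> I n y = I n x.
  move=> Ex; rewrite /I; case: (unpickle n) => [[p q]|]; last by exists 1.
  have gx r : x != g r by apply/eqP => xg; have [+ _] := gP r; rewrite -xg.
  exists (Num.min `|x - g p| `|x - g q|).
    by rewrite lt_min !normr_gt0 !subr_eq0 !gx.
  move=> y _; rewrite lt_min /= => /andP[xyp xyq].
  have [-> _] := same_side xyp; by have [_ ->] := same_side xyq.
have least_ex x : exists n, E x -> P x n /\ forall m, (m < n)%N -> ~ P x m.
  have [Ex|nEx] := pselect (E x); last by exists 0%N.
  have ex : exists n, `[< P x n >].
    by have [n xn] := Pex x Ex; exists n; apply/asboolP.
  exists (ex_minn ex) => _; case: ex_minnP => n /asboolP xn nmin; split=> // m mn.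
  by move=> /asboolP/nmin; rewrite leqNgt mn.
have [n_ n_P] := choice least_ex.
have tex n : exists t, (exists t', forall y, E y -> I n y -> U t' y) ->
    forall y, E y -> I n y -> U t y.
  have [[t tP]|h] := pselect (exists t', forall y, E y -> I n y -> U t' y).
    by exists t.
  by exists t0.
have [t_ t_P] := choice tex.
exists (fun x => t_ (n_ x)) => x Ex.
have [[Ix tx] nmin] := n_P x Ex.
split; first exact: t_P.
have [|m|d d0 dP] := @uniform_radius R (n_ x).+1
  (fun m d => forall y, E y -> `|x - y| < d -> I m y = I m x).
- by move=> m d d' d'd h y Ey xy; apply: h => //; exact: lt_le_trans xy d'd.
- exact: Iclopen.
exists d => // y Ey xy; congr t_.
have PE m : (m <= n_ x)%N -> P y m <-> P x m by move=> mn; rewrite /P (dP m).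
have [Py ymin] := n_P y Ey.
apply/eqP; rewrite eqn_leq; apply/andP; split; rewrite leqNgt; apply/negP.
- by move/ymin; apply; apply/PE.
- by move=> h; apply: (nmin _ h); apply/PE => //; exact: ltnW.
Qed.

(** * Transfer between compact target spaces *)
Lemma uncountable_segment (R : realType) (a b : R) : a < b ->
  uncountable (`[a, b]%classic : set R^o).
Proof.
move=> ab cI.
have /countable_lebesgue_measure0 : countable (`[a, b]%classic : set R).
  by rewrite -(eq_countable (card_setT _)).
rewrite lebesgue_measure_itv /= lte_fin ab => /eqP.
by rewrite -EFinB eqe subr_eq0 (gt_eqF ab).
Qed.

Lemma card_continuum_le_segment (R : realType) (a b : R) : a < b ->
  [set: continuum] #<= `[a, b]%classic.
Proof.
move=> ab.
have [psi [_ psi_sep]] := cantor_embedding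
  (@compact_set_type R R^o _ (@segment_compact R a b)) (uncountable_segment ab).
apply: (@inj_on_card_le _ _ _ _ (fun u => val (psi u))) => [u _|u v _ _ /val_inj uv].
  exact: set_valP.
apply/funext => i; have [d d0 dP] := psi_sep i.+1.
by apply: (dP u v) => //; rewrite uv mdistxx.
Qed.

Lemma subset_of_card (T K : Type) (B : set T) :
  [set: K] #<= B -> exists2 A, A `<=` B & A #= [set: K].
Proof.
have [[t0 _]|B0] := pselect (B !=set0).
  move=> /(card_le_inj_on t0)[f fB finj].
  by exists (range f); [move=> _ [k _ <-]; exact: fB|exact: inj_card_eq].
by move=> KB; exists B => //; rewrite card_eqPle; split=> //;
  rewrite (_ : B = set0) ?card_ge0//; exact/eqP/negPn/negP/set0P.
Qed.

(** The complement of [E] is dense: [f] would be uniformly continuous on a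
    segment contained in [E], and a segment has a subset of cardinality [K]. *)
Lemma nowhere_unif_gap (R : realType) (Y : metricType R) (E : set R) (K : Type)
    (f : R -> Y) :
  [set: K] #<= [set: continuum] -> continuous_nowhere_unif E K f ->
  forall a b, a < b -> exists2 c, a < c < b & ~ E c.
Proof.
move=> Kc [fE fK] a b ab; apply: contrapT => nc.
(* The middle third of the interval is a segment contained in it. *)
have IE : `[(a + a + b) / 3, (a + b + b) / 3]%classic `<=` E.
  move=> c; rewrite /= in_itv /= => /andP[ac cb]; apply: contrapT => nEc.
  by apply: nc; exists c => //; apply/andP; split; lra.
have [|A AI AK] := @subset_of_card R K `[(a + a + b) / 3, (a + b + b) / 3]%classic.
  by apply: card_le_trans Kc _; apply: card_continuum_le_segment; lra.
apply: (fK A (subset_trans AI IE) AK).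
have : unif_continuous_on `[(a + a + b) / 3, (a + b + b) / 3]%classic f.
  apply: compact_unif_continuous; first exact: segment_compact.
  exact: continuous_subspaceW IE fE.
move=> /unif_continuous_onP h; apply/unif_continuous_onP => e /h[d d0 dP].
by exists d => // x y Ax Ay; apply: dP; exact: AI.
Qed.

(** A continuous map from [E] to a compact metric space factors as a continuous
    map into the Cantor space, followed by a uniformly continuous map from the
    image. For each [n], the space is covered by finitely many balls of radius
    [1 / (n + 1)], and the bits of [x] tell which ball a locally constant
    selection assigns to [x]. *)
Lemma binary_factorization (R : realType) (Y : metricType R) (E : set R)
    (f : R -> Y) :
  compact [set: Y] -> (forall a b, a < b -> exists2 c, a < c < b & ~ E c) ->
  {within E, continuous f} ->
  exists bits : R -> nat -> bool,
    (forall x N, E x -> exists2 d, 0 < d & forall y, E y -> `|x - y| < d ->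
       forall i, (i < N)%N -> bits x i = bits y i) /\
    (forall e, 0 < e -> exists N, forall x y, E x -> E y ->
       (forall i, (i < N)%N -> bits x i = bits y i) -> mdist (f x) (f y) < e).
Proof.
move=> cY Egap /within_continuousP fE.
(* [s n] lists the centres of the balls, which the selection refers to by index. *)
have net_ex n := @compact_ball_cover R Y (fun=> n.+1%:R^-1) cY
  (fun=> ltac:(by rewrite invr_gt0)).
have [s sP] := choice net_ex.
pose U n j := [set x : R |
  (j < size (s n))%N /\ mdist (nth (f 0) (s n) j) (f x) < n.+1%:R^-1].
have sel_ex n := @locally_constant_selection R E nat 0%N (U n) Egap.
have [|c cP] := choice (P := fun n c => forall x, E x -> U n (c x) x /\
     exists2 d, 0 < d & forall y, E y -> `|x - y| < d -> c y = c x).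
  move=> n; apply: sel_ex => x Ex.
  have [p ps px] := sP n (f x).
  exists (index p (s n)).
  have [|d d0 dP] := fE x Ex (n.+1%:R^-1 - mdist p (f x)); first by rewrite subr_gt0.
  exists d => // y Ey xy; split; first by rewrite index_mem.
  rewrite nth_index//; apply: le_lt_trans (metric_triangle _ (f x) _) _.
  by rewrite -ltrBrDl; exact: dP.
exists (fun x i => if unpickle i is Some nj then c nj.1 x == nj.2 else false).
split.
- move=> x N Ex.
  have [|m|d d0 dP] := @uniform_radius R N (fun m d => forall y, E y -> `|x - y| < d ->
      (if unpickle m is Some nj then c nj.1 x == nj.2 else false) =
      (if unpickle m is Some nj then c nj.1 y == nj.2 else false)).
  + by move=> m d d' d'd h y Ey xy; apply: h => //; exact: lt_le_trans xy d'd.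
  + case: (unpickle m) => [[n j]|] /=; last by exists 1.
    have [_ [d d0 dP]] := cP n x Ex.
    by exists d => // y Ey xy; rewrite (dP y).
  by exists d => // y Ey xy i iN; exact: dP.
- move=> e e0; pose n := Num.trunc (2 / e).
  have ne : n.+1%:R^-1 < e / 2.
    have : 2 / e < n.+1%:R by exact: truncnS_gt.
    by rewrite -[X in _ -> _ < X]invf_div ltf_pV2 // posrE ?ltr0Sn ?divr_gt0.
  exists (\max_(j < size (s n)) (pickle (n, val j)).+1)%N => x y Ex Ey xy.
  have [[jx xj] _] := cP n x Ex; have [[jy yj] _] := cP n y Ey.
  have cxy : c n y = c n x.
    have := xy (pickle (n, c n x)); rewrite pickleK /= eqxx => /(_ _)/esym/eqP; apply.
    exact: (leq_bigmax (F := fun j : 'I__ => (pickle (n, val j)).+1) (Ordinal jx)).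
  rewrite (splitr e).
  apply: le_lt_trans (metric_triangle _ (nth (f 0) (s n) (c n x)) _) _.
  apply: ltrD; first by rewrite metric_sym; exact: lt_trans xj ne.
  by rewrite -cxy; exact: lt_trans yj ne.
Qed.

(** The composite of the two maps into the Cantor space and into [Z] is uniformly
    continuous only where [f] is. *)
Lemma nowhere_unif_transfer (R : realType) (Y Z : metricType R) (E : set R) (K : Type)
    (f : R -> Y) :
  [set: K] #<= [set: continuum] -> compact [set: Y] ->
  compact [set: Z] -> uncountable Z ->
  continuous_nowhere_unif E K f ->
  exists g : R -> Z, continuous_nowhere_unif E K g.
Proof.
move=> Kc cY cZ uZ fEK; have [fE fK] := fEK.
have [bits [bitsE bitsf]] := binary_factorization cY (nowhere_unif_gap Kc fEK) fE.
have [psi [psi_cont psi_sep]] := cantor_embedding cZ uZ.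
exists (psi \o bits); split.
- apply/within_continuousP => x Ex e e0.
  have [N NP] := psi_cont e e0; have [d d0 dP] := bitsE x N Ex.
  by exists d => // y Ey xy; apply: NP; exact: dP.
- move=> A AE AK /unif_continuous_onP gA; apply: (fK A AE AK).
  apply/unif_continuous_onP => e e0.
  have [N NP] := bitsf e e0; have [d d0 dP] := psi_sep N.
  have [d' d'0 d'P] := gA d d0.
  exists d' => // x y Ax Ay xy; apply: NP; [exact: AE|exact: AE|].
  by apply: dP; exact: d'P.
Qed.

(** * The theorem *)

(** [b0] is the value taken outside [E]. *)
Lemma corestriction_exists (T U : Type) (E : set T) (B : set U) (b0 : B)
    (f : T -> U) : f @` E `<=` B ->
  exists g : T -> B, forall x, E x -> \val (g x) = f x.
Proof.
move=> fB.
exists (fun x => if pselect (B (f x)) is left h then exist _ (f x) (mem_set h) else b0).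
by move=> x Ex; case: pselect => // nB; case: nB; apply: fB; exists x.
Qed.

Lemma continuous_nowhere_unif_corestriction (R : realType) (E : set R) (K : Type)
    (B : set R^o) (f : R -> R) (g : R -> B) :
  (forall x, E x -> \val (g x) = f x) ->
  continuous_nowhere_unif E K f <-> continuous_nowhere_unif E K g.
Proof.
move=> gf.
have gfd x y : E x -> E y -> mdist (g x) (g y) = `|f x - f y|.
  by move=> Ex Ey; rewrite -[LHS]/(@mdist R R^o (val (g x)) (val (g y))) !gf// mdistRE.
have unif A : A `<=` E -> unif_continuous_on A f <-> unif_continuous_on A g.
  move=> AE; rewrite unif_continuous_onRP unif_continuous_onP.
  by split=> h e /h[d d0 dP]; exists d => // x y Ax Ay /(dP x y Ax Ay);
    rewrite gfd//; exact: AE.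
split=> -[fE fK]; split.
- move/within_continuousRP : fE => fE; apply/within_continuousP => x Ex e e0.
  by have [d d0 dP] := fE x Ex e e0; exists d => // y Ey /(dP y Ey); rewrite gfd.
- by move=> A AE AK /(unif A AE); exact: fK.
- move/within_continuousP : fE => fE; apply/within_continuousRP => x Ex e e0.
  by have [d d0 dP] := fE x Ex e e0; exists d => // y Ey /(dP y Ey); rewrite gfd.
- by move=> A AE AK /(unif A AE); exact: fK.
Qed.

Lemma continuous_nowhere_unif_subset (X Y : uniformType) (E F : set X) (K : Type)
    (f : X -> Y) :
  F `<=` E -> continuous_nowhere_unif E K f -> continuous_nowhere_unif F K f.
Proof.
move=> FE [fE fK]; split; first exact: continuous_subspaceW FE fE.
by move=> A AF; apply: fK; exact: subset_trans AF FE.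
Qed.

Lemma card_eq_cover_piece (T L : Type) (E : set T) (F : nat -> set T) :
  uncountable_cofinality L -> E #= [set: L] ->
  (forall x, E x -> exists n, F n x) -> exists n, E `&` F n #= [set: L].
Proof.
move=> cofL EL EF; have := EL; rewrite card_eqPle => -[EleL LleE].
have [[x0 _]|E0] := pselect (E !=set0); last first.
  exists 0%N; rewrite (_ : E `&` F 0%N = E)//; apply/seteqP; split=> [x []//|x Ex].
  by exfalso; apply: E0; exists x.
have [h hE hinj] := card_le_inj_on x0 LleE.
have [|n nL] := @uncountable_cofinality_cover L (fun n => h @^-1` F n) cofL.
  by move=> l; exact: (EF _ (hE l I)).
exists n; rewrite card_eqPle; split.
  by apply: card_le_trans EleL; exact: subset_card_le.
move: nL; rewrite card_eqPle => -[_ /card_le_trans]; apply.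
apply: (@inj_on_card_le _ _ _ _ h) => [l Fl|l l' _ _]; first by split=> //; exact: hE.
by apply: hinj; rewrite inE.
Qed.

Theorem theorem3p2 (R : realType) (K L : Type)
  (K_uncountable : uncountable K) (L_uncountable : uncountable L)
  (KL : [set: K] #<= [set: L]) (Lc : [set: L] #<= [set: continuum]) :
  (uncountable_cofinality L -> (C8 R L K <-> C8_compact R L K)) /\
  (forall E : set R, C8_unit_interval_witness L K E ->
     forall Y : metricType R, compact [set: Y] -> uncountable Y ->
       exists f : R -> Y, continuous_nowhere_unif E K f).
Proof.
have Kc := card_le_trans KL Lc.
have cseg (a b : R) : compact [set: (`[a, b]%classic : set R^o)].
  by apply: (@compact_set_type R R^o); exact: segment_compact.
split=> [cofL|E [E01 EL [f fE01 fEK]] Y cY uY]; first split.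
- move=> [E [EL [f fEK]]].
  have [|n nL] := card_eq_cover_piece (F := fun n => [set x | `|f x| <= n%:R]) cofL EL.
    by move=> x _; exists (Num.trunc `|f x|).+1 => /=; exact/ltW/truncnS_gt.
  exists (E `&` [set x | `|f x| <= n%:R]); split=> //.
  have n0 : `[- n%:R, n%:R]%classic (0 : R) by rewrite /= in_itv /= oppr_le0 ler0n.
  have [|g gf] := @corestriction_exists _ _ (E `&` [set x | `|f x| <= n%:R])
    (`[- n%:R, n%:R]%classic : set R^o) (exist _ 0 (mem_set n0)) f.
    by move=> _ [x [_ /= xn] <-]; rewrite /= in_itv /= -ler_norml.
  exists (`[- n%:R, n%:R]%classic : set R^o); split; first exact: cseg.
  exists g; apply/(continuous_nowhere_unif_corestriction _ gf).
  by apply: continuous_nowhere_unif_subset fEK => x [].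
- move=> [E [EL [Y [cY [f fEK]]]]]; exists E; split=> //.
  have [g gEK] := nowhere_unif_transfer Kc cY (cseg 0 1) (uncountable_segment ltr01) fEK.
  exists (fun x => \val (g x)).
  exact/(continuous_nowhere_unif_corestriction K (g := g)).
- have i0 : `[0, 1]%classic (0 : R) by rewrite /= in_itv /= lexx ler01.
  have [g gf] := @corestriction_exists _ _ E (`[0, 1]%classic : set R^o)
    (exist _ 0 (mem_set i0)) f fE01.
  apply: (nowhere_unif_transfer Kc (cseg 0 1) cY uY (f := g)).
  exact/(continuous_nowhere_unif_corestriction K gf).
Qed.
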